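(* Let $\mathbb U$ and $\mathbb V$ be two Banach spaces with $\dim\mathbb U\ge2$ and $\dim\mathbb V\ge2$, and let $B:\mathbb U\to\mathbb V^*$ be a linear, continuous and bounded-below operator, with continuity constant $M_B>0$ and bounded-below constant $\gamma_B>0$, i.e. $\gamma_B\|w\|_{\mathbb U}\le\|Bw\|_{\mathbb V^*}\le M_B\|w\|_{\mathbb U}$ for all $w\in\mathbb U$. Assume that $\mathbb V$ and $\mathbb V^*$ are reflexive and strictly convex. Let $\mathbb U_n\subset\mathbb U$ and $\mathbb V_m\subset\mathbb V$ be finite-dimensional subspaces such that the Fortin condition holds: there exist an operator $\Pi:\mathbb V\to\mathbb V_m$ and constants $C_\Pi>0$, $D_\Pi>0$ (independent of $n$ and $m$ when a family of pairs $(\mathbb U_n,\mathbb V_m)$ is considered) such that $\|\Pi v\|_{\mathbb V}\le C_\Pi\|v\|_{\mathbb V}$ and $\|v-\Pi v\|_{\mathbb V}\le D_\Pi\|v\|_{\mathbb V}$ for all $v\in\mathbb V$, and $\langle Bw_n,v-\Pi v\rangle_{\mathbb V^*,\mathbb V}=0$ for all $w_n\in\mathbb U_n$ and all $v\in\mathbb V$. Given $f=Bu\in\mathbb V^*$ with $u\in\mathbb U$, let $(r_m,u_n)\in\mathbb V_m\times\mathbb U_n$ be the unique solution of the discrete mixed problem $$\langle J_{\mathbb V}(r_m),v_m\rangle_{\mathbb V^*,\mathbb V}+\langle Bu_n,v_m\rangle_{\mathbb V^*,\mathbb V}=\langle f,v_m\rangle_{\mathbb V^*,\mathbb V}\quad\forall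 v_m\in\mathbb V_m,\qquad\langle B^*r_m,w_n\rangle_{\mathbb U^*,\mathbb U}=0\quad\forall w_n\in\mathbb U_n .$$ Then $u_n$ satisfies the a priori error estimate $$\|u-u_n\|_{\mathbb U}\le C\inf_{w_n\in\mathbb U_n}\|u-w_n\|_{\mathbb U}$$ with $$C=\min\left\{\frac{C_\Pi}{\gamma_B}\bigl(1+C_{\mathrm{AO}}(\mathbb V)\bigr)M_B\,C_{\mathrm{BM}}(\mathbb U),\ 1+\frac{C_\Pi}{\gamma_B}\bigl(1+C_{\mathrm{AO}}(\mathbb V)\bigr)M_B\right\},$$ where $C_{\mathrm{BM}}(\mathbb U)$ is the Banach--Mazur constant of $\mathbb U$ and $C_{\mathrm{AO}}(\mathbb V)$ is the asymmetric-orthogonality constant of $\mathbb V$.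
   Context: All spaces are real. $B^*:\mathbb V\to\mathbb U^*$ is given by $\langle B^*v,w\rangle_{\mathbb U^*,\mathbb U}=\langle Bw,v\rangle_{\mathbb V^*,\mathbb V}$. For a normed space $\mathbb Y$, the duality mapping is $\mathcal J_{\mathbb Y}(y)=\{y^*\in\mathbb Y^*:\langle y^*,y\rangle=\|y\|_{\mathbb Y}^2=\|y^*\|_{\mathbb Y^*}^2\}$. A normed space is strictly convex if $\|\theta y_1+(1-\theta)y_2\|<1$ whenever $y_1\ne y_2$, $\|y_1\|=\|y_2\|=1$, $\theta\in(0,1)$. If $\mathbb Y$ and $\mathbb Y^*$ are strictly convex and reflexive Banach spaces, then $\mathcal J_{\mathbb Y}(y)=\{J_{\mathbb Y}(y)\}$ is single-valued and $J_{\mathbb Y}:\mathbb Y\to\mathbb Y^*$ is a bijection (known fact). Under the stated hypotheses the discrete mixed problem has a unique solution. Banach--Mazur constant (for $\dim\mathbb Y\ge2$): $C_{\mathrm{BM}}(\mathbb Y):=\sup\{d_{\mathrm{BM}}(\mathbb W,\ell_2(\mathbb R^2))^2:\mathbb W\subset\mathbb Y\text{ a subspace},\ \dim\mathbb W=2\}$, where $d_{\mathrm{BM}}(\mathbb W,\ell_2(\mathbb R^2)):=\inf\{\|T\|\,\|T^{-1}\|: T:\mathbb W\to\ell_2(\mathbb R^2)\text{ a linear isomorphism}\}$ and $\ell_2(\mathbb R^2)$ is $\mathbb R^2$ with the Euclidean norm. It is known that $1\le C_{\mathrm{BM}}(\mathbb Y)\le2$. Asymmetric-orthogonality constant (for $\dim\mathbb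 Y\ge2$): $$C_{\mathrm{AO}}(\mathbb Y):=\sup\left\{\frac{\langle z_0^*,z\rangle_{\mathbb Y^*,\mathbb Y}}{\|z\|_{\mathbb Y}\|z_0\|_{\mathbb Y}}:(z_0,z)\in\mathcal O_{\mathbb Y},\ z_0^*\in\mathcal J_{\mathbb Y}(z_0)\right\},$$ $\mathcal O_{\mathbb Y}:=\{(z_0,z)\in\mathbb Y\times\mathbb Y:\exists z^*\in\mathcal J_{\mathbb Y}(z)\text{ with }\langle z^*,z_0\rangle=0\}$ (the supremum being over nonzero $z_0,z$).
   Formalization: The subspace U_n is additionally assumed to be nonzero; for U_n = {0} one can take Π = 0 with C_Π arbitrarily small, so u_n = 0 and the estimate with C < 1 fails for u ≠ 0. *)

(* Defs.v *)
From HB Require Import structures.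
From mathcomp Require Import all_boot all_order all_algebra.
From mathcomp Require Import all_classical all_reals.
From mathcomp Require Import topology normedtype.
From mathcomp Require Import ring.

Set Implicit Arguments.
Unset Strict Implicit.
Unset Printing Implicit Defensive.

Import Order.TTheory GRing.Theory Num.Theory.
Import numFieldNormedType.Exports.

Local Open Scope classical_set_scope.
Local Open Scope ring_scope.

(* [sup] is the real supremum (0 on unbounded sets), so this is the operator
   norm only for bounded linear [f]. It takes a bare function because the maps
   between 2-dimensional spaces below are linear, hence automatically bounded. *)
Definition opnorm (R : realType) (X Z : normedModType R) (f : X -> Z) : R :=
  sup [set `|f x| | x in [set x : X | `|x| <= 1]].

Definition clin_pred (R : realType) (X Z : normedModType R) : {pred X -> Z} :=
  fun f => `[< linear f /\ continuous f >].

Record clin (R : realType) (X Z : normedModType R) := CLin {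
  clin_fun :> X -> Z;
  clin_funP : clin_fun \in @clin_pred R X Z }.

Section clin_lmodule.
Context (R : realType) (X Z : normedModType R).

HB.instance Definition _ := [isSub for @clin_fun R X Z].
HB.instance Definition _ := [Choice of clin X Z by <:].

Lemma clin_submod_closed : submod_closed (@clin_pred R X Z).
Proof.
split.
  apply/asboolP; split => [a x y|x]; first by rewrite scaler0 addr0.
  exact: cvg_cst.
move=> a f g /asboolP[lf cf] /asboolP[lg cg]; apply/asboolP; split.
  move=> b x y; rewrite !fctE lf lg !scalerDr !scalerA (mulrC a b).
  by rewrite addrACA.
move=> x; apply: (@cvgD _ Z _ (nbhs x)); last exact: cg.
by apply: cvgZl_tmp; exact: cf.
Qed.

HB.instance Definition _ :=
  GRing.isSubmodClosed.Build R (X -> Z) (@clin_pred R X Z) clin_submod_closed.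
HB.instance Definition _ := [SubChoice_isSubLmodule of clin X Z by <:].

Lemma clin_linear (f : clin X Z) : linear f.
Proof. by case: f => f /= /asboolP[]. Qed.

HB.instance Definition _ (f : clin X Z) :=
  GRing.isLinear.Build R X Z *:%R f (@clin_linear f).

Lemma clin_continuous (f : clin X Z) : continuous f.
Proof. by case: f => f /= /asboolP[]. Qed.

Lemma clin_has_sup (f : clin X Z) :
  has_sup [set `|f x| | x in [set x : X | `|x| <= 1]].
Proof.
split; first by exists `|f 0|, 0 => //=; rewrite normr0.
have /linear_boundedP/pinfty_ex_gt0[M M0 fM] :=
  @continuous_linear_bounded R X Z 0 f (@clin_continuous f 0).
exists M => _ [x /= x1 <-]; apply: le_trans (fM x) _.
by rewrite -[leRHS]mulr1 ler_wpM2l// ltW.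
Qed.

Lemma opnorm_ub (f : clin X Z) x : `|f x| <= opnorm f * `|x|.
Proof.
have [->|x0] := eqVneq x 0; first by rewrite linear0 !normr0 mulr0.
rewrite -ler_pdivrMr ?normr_gt0//.
rewrite -[leLHS](_ : `|f (`|x|^-1 *: x)| = _); last first.
  by rewrite linearZ/= normrZ normfV normr_id mulrC.
apply: ub_le_sup; first by case: (clin_has_sup f).
by exists (`|x|^-1 *: x) => //=; rewrite normrZ normfV normr_id mulVf ?normr_eq0.
Qed.

Lemma opnorm_le (f : clin X Z) M :
  (forall x, `|x| <= 1 -> `|f x| <= M) -> opnorm f <= M.
Proof.
move=> fM; apply: ge_sup; first by case: (clin_has_sup f).
by move=> _ [x /= x1 <-]; exact: fM.
Qed.

Lemma opnorm_ge0 (f : clin X Z) : 0 <= opnorm f.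
Proof.
by apply: ub_le_sup; [case: (clin_has_sup f)|exists 0; rewrite /= ?linear0 normr0].
Qed.

Lemma opnormD (f g : clin X Z) : opnorm (f + g) <= opnorm f + opnorm g.
Proof.
apply: opnorm_le => x x1; apply: le_trans (ler_normD _ _) _.
by apply: lerD; apply: le_trans (opnorm_ub _ _) _; rewrite ler_piMr ?opnorm_ge0.
Qed.

Lemma opnormZ (a : R) (f : clin X Z) : opnorm (a *: f) = `|a| * opnorm f.
Proof.
have le (b : R) (g : clin X Z) : opnorm (b *: g) <= `|b| * opnorm g.
  apply: opnorm_le => x x1; rewrite -[leLHS]/`|b *: g x| normrZ ler_wpM2l//.
  by apply: le_trans (opnorm_ub _ _) _; rewrite ler_piMr ?opnorm_ge0.
apply/eqP; rewrite eq_le; apply/andP; split; first exact: le.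
have [->|a0] := eqVneq a 0; first by rewrite normr0 mul0r; exact: opnorm_ge0.
rewrite -ler_pdivlMl ?normr_gt0// -normfV.
by apply: le_trans (le _ _); rewrite scalerA mulVf// scale1r.
Qed.

Lemma opnorm_eq0 (f : clin X Z) : opnorm f = 0 -> f = 0.
Proof.
move=> f0; apply/val_inj/funext => x /=; apply/eqP.
by rewrite -normr_le0 (le_trans (opnorm_ub f x))// f0 mul0r.
Qed.

HB.instance Definition _ :=
  Lmodule_isNormed.Build R (clin X Z) opnormD opnormZ opnorm_eq0.

End clin_lmodule.

(* [R^o] is R as a normed space over itself. *)
Definition dual (R : realType) (Y : normedModType R) := clin Y R^o.

HB.instance Definition _ (R : realType) (Y : normedModType R) :=
  NormedModule.on (dual Y).

Section bidual.
Context (R : realType) (Y : normedModType R).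

Lemma bidual_emb_subproof (y : Y) :
  (fun f : dual Y => f y : R^o) \in @clin_pred R (dual Y) R^o.
Proof.
pose e (f : dual Y) : R^o := f y.
have le : linear e by [].
pose E : {linear dual Y -> R^o} :=
  HB.pack e (GRing.isLinear.Build R (dual Y) R^o *:%R e le).
apply/asboolP; split; first exact: le.
apply: (@bounded_linear_continuous _ _ _ E); apply/linear_boundedP.
exists `|y|; split; first exact: num_real.
move=> r /ltW yr f; apply: le_trans (opnorm_ub f y) _.
by rewrite [leLHS]mulrC ler_wpM2r// opnorm_ge0.
Qed.

Definition bidual_emb (y : Y) : dual (dual Y) := CLin (bidual_emb_subproof y).

Definition reflexive_space := forall phi : dual (dual Y), exists y, phi = bidual_emb y.

Definition strictly_convex := forall (y1 y2 : Y) (t : R),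
  y1 != y2 -> `|y1| = 1 -> `|y2| = 1 -> 0 < t < 1 ->
  `|t *: y1 + (1 - t) *: y2| < 1.

Definition duality_mapping (y : Y) : set (dual Y) :=
  [set ys : dual Y | ys y = `|y| ^+ 2 /\ `|y| ^+ 2 = `|ys| ^+ 2].

(* The element of the duality mapping, meant for spaces where the latter is
   single-valued; the default 0 is only reached if the duality mapping is empty,
   which the Hahn-Banach theorem excludes. *)
Definition Jmap (y : Y) : dual Y := xget 0 (duality_mapping y).

End bidual.

Section adjoint.
Context (R : realType) (U V : normedModType R) (B : clin U (dual V)).

Lemma adjoint_subproof (v : V) :
  (fun w : U => B w v : R^o) \in @clin_pred R U R^o.
Proof.
apply/asboolP; split; first by move=> a x y; rewrite linearP.
move=> w; apply: (@continuous_comp _ _ _ B (bidual_emb v)).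
  exact: clin_continuous.
exact: clin_continuous.
Qed.

Definition adjoint (v : V) : dual U := CLin (adjoint_subproof v).

End adjoint.

Definition lin_indep (R : realType) (E : lmodType R) n (e : 'I_n -> E) :=
  forall c : 'I_n -> R, \sum_(i < n) c i *: e i = 0 -> forall i, c i = 0.

Definition dim_ge (R : realType) (E : lmodType R) (n : nat) :=
  exists e : 'I_n -> E, lin_indep e.

Definition has_dim (R : realType) (E : lmodType R) (n : nat) :=
  exists e : 'I_n -> E,
    lin_indep e /\ forall x, exists c : 'I_n -> R, x = \sum_(i < n) c i *: e i.

Definition finite_dim (R : realType) (E : lmodType R) := exists n, has_dim E n.

(* A linear subspace of [Y] is a [W : submodClosed Y]; [subsp W] is [W] as a
   normed space in its own right. *)
Record subsp (R : realType) (Y : normedModType R) (W : submodClosed Y) := Subsp {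
  subsp_val : Y;
  subsp_valP : subsp_val \in W }.

Section subsp_normed.
Context (R : realType) (Y : normedModType R) (W : submodClosed Y).

HB.instance Definition _ := [isSub for @subsp_val R Y W].
HB.instance Definition _ := [Choice of subsp W by <:].
HB.instance Definition _ := [SubChoice_isSubLmodule of subsp W by <:].

Let nm (x : subsp W) : R := `|val x|.

Let nmD x y : nm (x + y) <= nm x + nm y.
Proof. exact: ler_normD. Qed.

Let nmZ (a : R) x : nm (a *: x) = `|a| * nm x.
Proof. exact: normrZ. Qed.

Let nm_eq0 x : nm x = 0 -> x = 0.
Proof. by move=> /normr0_eq0 x0; exact: val_inj. Qed.

HB.instance Definition _ := Lmodule_isNormed.Build R (subsp W) nmD nmZ nm_eq0.

End subsp_normed.

(* An alias is needed because ['rV[R]_2] carries the max norm. *)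
Definition ell2_plane (R : realType) := 'rV[R]_2.

Section ell2_plane_normed.
Context (R : realType).

HB.instance Definition _ := GRing.Lmodule.on (ell2_plane R).

Let nm (x : ell2_plane R) : R := Num.sqrt (\sum_(i < 2) x 0 i ^+ 2).

Let nmE x : nm x = Num.sqrt (x 0 0 ^+ 2 + x 0 1 ^+ 2).
Proof.
rewrite /nm big_ord_recl big_ord1; congr (Num.sqrt (_ + x 0 _ ^+ 2)).
exact/val_inj.
Qed.

Let nmD x y : nm (x + y) <= nm x + nm y.
Proof.
rewrite !nmE !mxE.
set a := x 0 0; set b := x 0 1; set c := y 0 0; set d := y 0 1.
have h (s t : R) : 0 <= s ^+ 2 + t ^+ 2 by rewrite addr_ge0 ?sqr_ge0.
rewrite -[leRHS]ger0_norm ?addr_ge0 ?sqrtr_ge0// -sqrtr_sqr ler_wsqrtr//.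
rewrite [leRHS]sqrrD !sqr_sqrtr// -sqrtrM//.
have cs : a * c + b * d <= Num.sqrt ((a ^+ 2 + b ^+ 2) * (c ^+ 2 + d ^+ 2)).
  apply: le_trans (ler_norm _) _; rewrite -sqrtr_sqr ler_wsqrtr//.
  rewrite -subr_ge0 [leRHS](_ : _ = (a * d - b * c) ^+ 2) ?sqr_ge0//.
  by ring.
move: cs; set S := Num.sqrt _ => cs.
rewrite -subr_ge0 [leRHS](_ : _ = (S - (a * c + b * d)) *+ 2); last by ring.
by rewrite mulrn_wge0// subr_ge0.
Qed.

Let nmZ (k : R) x : nm (k *: x) = `|k| * nm x.
Proof.
rewrite !nmE !mxE !exprMn -mulrDr sqrtrM ?sqr_ge0//.
by rewrite sqrtr_sqr.
Qed.

Let nm_eq0 x : nm x = 0 -> x = 0.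
Proof.
rewrite nmE => /eqP; rewrite sqrtr_eq0 => x0.
have sq0 (s t : R) : s ^+ 2 + t ^+ 2 <= 0 -> s = 0.
  move=> st; apply/eqP; rewrite -sqrf_eq0 eq_le sqr_ge0 andbT.
  by apply: le_trans st; rewrite lerDl sqr_ge0.
have x00 := sq0 _ _ x0; rewrite addrC in x0; have x01 := sq0 _ _ x0.
apply/rowP => i; rewrite mxE; case: i => [[|[|//]] ilt].
  by rewrite -[RHS]x00; congr (x 0 _); exact/val_inj.
by rewrite -[RHS]x01; congr (x 0 _); exact/val_inj.
Qed.

HB.instance Definition _ := Lmodule_isNormed.Build R (ell2_plane R) nmD nmZ nm_eq0.

End ell2_plane_normed.

Definition d_BM (R : realType) (W : normedModType R) : R :=
  inf [set r | exists (T : {linear W -> ell2_plane R})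
                      (Tinv : {linear ell2_plane R -> W}),
         [/\ cancel T Tinv, cancel Tinv T & r = opnorm T * opnorm Tinv]].

Definition C_BM (R : realType) (Y : normedModType R) : R :=
  sup [set r | exists W : submodClosed Y,
         has_dim (subsp W) 2 /\ r = d_BM (subsp W) ^+ 2].

(* [orth z0 z] is the relation (z0, z) \in O_Y. *)
Definition orth (R : realType) (Y : normedModType R) (z0 z : Y) :=
  exists2 zs, duality_mapping z zs & zs z0 = 0.

Definition C_AO (R : realType) (Y : normedModType R) : R :=
  sup [set r | exists (z0 z : Y) (z0s : dual Y),
         [/\ z0 != 0, z != 0, orth z0 z, duality_mapping z0 z0s
           & r = z0s z / (`|z| * `|z0|)]].

(* Main.v *)
(* Put x = u - w and p = u_n - w for w in U_n. The pair (x, p) solves the same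
   mixed problem, and so does every (a x + b p, (a + b) p), because the solution
   operator is homogeneous and additive with respect to U_n.

   Stability |p| <= K |x| with K = C_Pi / gamma_B (1 + C_AO) M_B: let s be the
   norm of B p restricted to V_m, attained at a unit vector y of V_m, and extend
   this restriction to V by Hahn-Banach without increasing its norm. The extension
   is, up to scaling, in the duality mapping of y, and it vanishes at the residual
   r since B p does; hence r is orthogonal to y and the definition of C_AO bounds
   J(r) at y. The Fortin operator then turns s into the full norm of B p.

   This gives the constant 1 + K at once. For K C_BM, the stability bound says that
   on the plane spanned by x and p the projection a x + b p |-> (a + b) p has norm
   at most K. In a Euclidean plane a projection onto a line and the complementary
   projection have equal norms; transporting the plane to the Euclidean one and
   back costs a factor d_BM ^ 2. *)

From HB Require Import structures.
Require Import Defs.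
From mathcomp Require Import all_boot all_order all_algebra.
From mathcomp Require Import all_classical all_reals.
From mathcomp Require Import topology normedtype derive.
From mathcomp Require Import ring lra.

Set Implicit Arguments.
Unset Strict Implicit.
Unset Printing Implicit Defensive.

Import Order.TTheory GRing.Theory Num.Theory.
Import numFieldNormedType.Exports.

Local Open Scope classical_set_scope.
Local Open Scope ring_scope.

(** * The Hahn-Banach theorem for a sublinear functional *)

Section hahn_banach.
Context (R : realType) (E : lmodType R) (p : E -> R).
Hypothesis pD : forall x y, p (x + y) <= p x + p y.
Hypothesis pZ : forall t x, 0 < t -> p (t *: x) = t * p x.

(* Partial functionals are handled as graphs; domination by [p] makes such a
   linear relation single-valued. *)
Definition dominated_graph (G : set (E * R)) :=
  [/\ G (0, 0),
      forall t x y a b, G (x, a) -> G (y, b) -> G (t *: x + y, t * a + b)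
    & forall x a, G (x, a) -> a <= p x].

Lemma dominated_graphZ G t x a :
  dominated_graph G -> G (x, a) -> G (t *: x, t * a).
Proof.
by move=> [G0 Gl _] Gx; have := Gl t _ _ _ _ Gx G0; rewrite !addr0.
Qed.

Lemma dominated_graph_fun G x a b :
  dominated_graph G -> G (x, a) -> G (x, b) -> a = b.
Proof.
move=> GG Gxa Gxb; have p0 : p 0 <= 0.
  by have := pZ 0 (ltr0n R 2); rewrite scaler0; lra.
have h c d : G (x, c) -> G (x, d) -> d <= c.
  move=> Gc Gd; have [_ Gl Gp] := GG.
  have := Gl (-1) _ _ _ _ Gc Gd; rewrite scaleN1r addNr => /Gp.
  by move=> /le_trans/(_ p0); lra.
by apply/le_anti; rewrite !h.
Qed.

(** A value [c] at [v] is admissible if [a - p (x - v) <= c <= p (y + v) - b] for all [(x, a)] and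
    [(y, b)] in [G]. Subadditivity puts every lower bound below every upper one, so the supremum of
    the lower bounds serves. *)
Lemma dominated_graph_extend G v :
  dominated_graph G -> exists2 G', dominated_graph G' &
    G `<=` G' /\ exists c, G' (v, c).
Proof.
move=> GG; have [G0 Gl Gp] := GG.
pose A := [set r | exists x a, G (x, a) /\ r = a - p (x - v)].
have Aub y b : G (y, b) -> ubound A (p (y + v) - b).
  move=> Gy _ [x [a [Gx ->]]]; have := Gl 1 _ _ _ _ Gx Gy.
  rewrite scale1r mul1r => /Gp; have := pD (x - v) (y + v).
  by rewrite addrACA addNr addr0; lra.
pose c := sup A.
have cle y b : G (y, b) -> c <= p (y + v) - b.
  move=> Gy; apply: ge_sup (Aub _ _ Gy).
  by exists (0 - p (0 - v)), 0, 0.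
have cge x a : G (x, a) -> a - p (x - v) <= c.
  move=> Gx; apply: ub_le_sup; first by exists (p (0 + v) - 0); exact: Aub.
  by exists x, a.
pose G' : set (E * R) :=
  [set z | exists x a t, G (x, a) /\ z = (x + t *: v, a + t * c)].
have GG' : G `<=` G'.
  by move=> [x a] Gx; exists x, a, 0; rewrite scale0r mul0r !addr0.
exists G'; last split=> //.
- split; first exact: GG'.
    move=> s _ _ _ _ [x [a [t [Gx [-> ->]]]]] [y [b [q [Gy [-> ->]]]]].
    exists (s *: x + y), (s * a + b), (s * t + q); split; first exact: Gl.
    congr (_, _); last by ring.
    by rewrite scalerDr scalerA scalerDl addrACA.
  move=> _ _ [x [a [t [Gx [-> ->]]]]].
  have key s (y w : E) : 0 < s -> s * p (s^-1 *: y + w) = p (y + s *: w).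
    by move=> s0; rewrite -pZ// scalerDr scalerA divff ?scale1r// gt_eqF.
  (* Rescaling by the inverse of [t] or of [- t] reduces domination to the upper bound on [c] for
     positive [t] and to the lower bound for negative [t]. *)
  have [t0|t0|->] := ltgtP t 0; last first.
  + by rewrite scale0r mul0r !addr0; exact: Gp.
  + have := cle _ _ (dominated_graphZ t^-1 GG Gx).
    rewrite -(ler_pM2l t0) mulrBr key// mulrA divff ?gt_eqF// mul1r.
    by lra.
  + have s0 : 0 < - t by rewrite oppr_gt0.
    have := cge _ _ (dominated_graphZ (- t)^-1 GG Gx).
    rewrite -(ler_pM2l s0) mulrBr key// mulrA divff ?gt_eqF// mul1r.
    by rewrite scalerN scaleNr opprK; lra.
- by exists c, 0, 0, 1; rewrite scale1r mul1r !add0r.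
Qed.

Lemma hahn_banach_graph G0 : dominated_graph G0 ->
  exists g : E -> R, [/\ linear (g : E -> R^o),
    forall x a, G0 (x, a) -> g x = a & forall x, g x <= p x].
Proof.
move=> G0G.
(* Ordering the added parts [A] instead of the graphs themselves keeps [G0] inside every candidate
   and covers the empty chain. *)
have [|A [GA maxA]] := @Zorn_bigcup _ (fun A => dominated_graph (G0 `|` A)).
  move=> F FP Ftot; have sub X : F X -> G0 `|` X `<=` G0 `|` \bigcup_(X in F) X.
    by move=> FX; apply: setUS; exact: bigcup_sup.
  have [G00 G0l G0p] := G0G; split; first by left.
    move=> t x y a b Gx Gy.
    have [[X FX [Xx Xy]]|[x0 y0]] :
        (exists2 X, F X & (G0 `|` X) (x, a) /\ (G0 `|` X) (y, b)) \/
        (G0 (x, a) /\ G0 (y, b)).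
      case: Gx Gy => [Gx|[X FX Xx]] [Gy|[Y FY Yy]]; first by right.
      - by left; exists Y => //; split; [left|right].
      - by left; exists X => //; split; [right|left].
      - left; have [XY|YX] := Ftot _ _ FX FY.
          by exists Y => //; split; right => //; exact: XY.
        by exists X => //; split; right => //; exact: YX.
    + by apply: (sub _ FX); have [_ + _] := FP _ FX; exact.
    + by left; exact: G0l.
  move=> x a [/G0p//|[X FX Xx]]; have [_ _] := FP _ FX; apply; by right.
set G := G0 `|` A in GA.
(* If [v] had no value, the one-step extension at [v] would contradict maximality. *)
have total v : exists c, G (v, c).
  have [G' GG' [sub [c Gc]]] := dominated_graph_extend v GA.
  exists c; right; apply: contrapT => nA; apply: (maxA G').
    split; last by move=> /(_ _ Gc).
    by move=> z Az; apply: sub; right.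
  rewrite (_ : G0 `|` G' = G')//; apply/setUidPr => z G0z.
  by apply: sub; left.
have [g gP] := choice total.
exists g; split.
- move=> t x y; have [_ Gl _] := GA.
  exact: dominated_graph_fun GA (gP _) (Gl _ _ _ _ _ (gP x) (gP y)).
- by move=> x a G0x; apply: dominated_graph_fun GA (gP x) _; left.
- by move=> x; have [_ _] := GA; apply; exact: gP.
Qed.

End hahn_banach.

Lemma bounded_linear_clin (R : realType) (X Z : normedModType R) (T : X -> Z)
    (M : R) :
  linear T -> (forall x, `|T x| <= M * `|x|) -> T \in @clin_pred R X Z.
Proof.
move=> Tl TM; pose L : {linear X -> Z} :=
  HB.pack T (GRing.isLinear.Build R X Z *:%R T Tl).
apply/asboolP; split=> //; apply: (@bounded_linear_continuous _ _ _ L).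
apply/linear_boundedP; exists M; split; first exact: num_real.
move=> r /ltW Mr x; apply: le_trans (TM x) _.
by rewrite ler_wpM2r.
Qed.

(** * Norm-preserving extension of functionals *)

Section dual_extension.
Context (R : realType) (V : normedModType R).

Lemma hahn_banach_normed (M : R) (G : set (V * R)) : 0 <= M ->
  dominated_graph (fun x => M * `|x|) G ->
  exists2 g : dual V, `|g| <= M & forall x a, G (x, a) -> g x = a.
Proof.
move=> M0 GG.
have [||g [gl gG gM]] := hahn_banach_graph _ _ GG.
- by move=> x y; rewrite -mulrDr ler_wpM2l// ler_normD.
- by move=> t x t0; rewrite normrZ gtr0_norm// mulrCA.
have gN x : `|g x| <= M * `|x|.
  rewrite ler_norml gM andbT lerNl; have := gM (- x).
  pose L : {linear V -> R^o} :=
    HB.pack (g : V -> R^o) (GRing.isLinear.Build R V R^o *:%R (g : V -> R^o) gl).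
  by rewrite -[g]/(L : V -> R^o) linearN normrN.
exists (CLin (bounded_linear_clin gl gN)) => //.
apply: opnorm_le => x x1; apply: le_trans (gN x) _.
by rewrite ler_piMr.
Qed.

Lemma dual_extension (W : submodClosed V) (phi : dual V) (M : R) : 0 <= M ->
  (forall x, x \in W -> phi x <= M * `|x|) ->
  exists2 g : dual V, `|g| <= M & forall x, x \in W -> g x = phi x.
Proof.
move=> M0 phiM.
have [//||g gM gG] := @hahn_banach_normed M [set z | z.1 \in W /\ z.2 = phi z.1].
  split=> [|t x y _ _ [/= xW ->] [/= yW ->]|x _ [/= xW ->]] /=.
  - by rewrite rpred0 linear0.
  - by rewrite rpredD ?rpredZ// linearP.
  - exact: phiM.
by exists g => // x xW; exact: gG.
Qed.

(** The functional sending [t *: v] to [t * |v|^2] has norm [|v|] on the line through [v], and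
    Hahn-Banach extends it without increasing this norm. So [Jmap] never takes its default value. *)
Lemma duality_mapping_neq0 (v : V) : duality_mapping v !=set0.
Proof.
have [||g gM gG] := @hahn_banach_normed `|v|
    [set z | exists t, z = (t *: v, t * `|v| ^+ 2)] => //.
  split.
  - by exists 0; rewrite scale0r mul0r.
  - move=> t x y a b [s [-> ->]] [q [-> ->]]; exists (t * s + q).
    by rewrite scalerDl scalerA mulrDl mulrA.
  - move=> _ _ [t [-> ->]]; rewrite normrZ [leRHS]mulrCA -expr2.
    by rewrite ler_wpM2r ?sqr_ge0// ler_norm.
have gv : g v = `|v| ^+ 2 by apply: gG; exists 1; rewrite scale1r mul1r.
exists g; split => //; congr (_ ^+ 2); apply/le_anti; rewrite gM andbT.
have [->|v0] := eqVneq v 0; first by rewrite normr0.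
rewrite -(@ler_pM2r _ `|v|) ?normr_gt0// -expr2 -gv.
by apply: le_trans (ler_norm _) _; exact: opnorm_ub.
Qed.

End dual_extension.

(** * Compactness in finite dimension *)

Section finite_dimension.
Context (R : realType).

Lemma lincomb_continuous (E : normedModType R) n (e : 'I_n -> E) :
  continuous (fun c : 'rV[R]_n => \sum_i c 0 i *: e i).
Proof.
apply: continuous_big => [|i _ c]; first exact: add_continuous.
by apply: (@cvgZr_tmp _ _ _ (nbhs c)); exact: coord_continuous.
Qed.

(** On the compact unit sphere of coordinate vectors the norm of the combination attains a minimum,
    positive by independence; [M] is its inverse. The sphere is empty for [n = 0], which is treated
    apart. *)
Lemma lin_indep_coord_bound (E : normedModType R) n (e : 'I_n -> E) :
  lin_indep e ->
  exists2 M : R, 0 < M & forall c i, `|c i| <= M * `|\sum_i c i *: e i|.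
Proof.
case: n e => [|n] e ei; first by exists 1 => // c [].
pose N (c : 'rV[R]_n.+1) := `|\sum_i c 0 i *: e i|.
have Nc : continuous N.
  by move=> c; apply: continuous_comp; [exact: lincomb_continuous|exact: norm_continuous].
pose S := [set c : 'rV[R]_n.+1 | `|c| = 1].
have coordE (c : 'rV[R]_n.+1) i : `|c 0 i| <= `|c|.
  rewrite [leRHS]/Num.norm/= mx_normrE; apply/bigmax_geP; right => /=.
  by exists (0, i).
have S0 : S !=set0.
  have o0 : const_mx 1 != 0 :> 'rV[R]_n.+1.
    by apply/eqP => /rowP/(_ ord0)/eqP; rewrite !mxE oner_eq0.
  exists (`|const_mx 1 : 'rV[R]_n.+1|^-1 *: const_mx 1).
  by rewrite /S/= normrZ normfV normr_id mulVf ?normr_eq0.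
have cS : compact S.
  apply: bounded_closed_compact.
    by exists 1; split=> // r /ltW r1 c /= ->.
  apply: (preimage_closed _ (@closed_eq R 1)).
  by move=> c _; exact: norm_continuous.
have [|c0 c0S c0min] := EVT_min_rV S0 cS (f := N).
  exact: continuous_subspaceT.
have m0 : 0 < N c0.
  rewrite normr_gt0; apply/eqP => /ei c00.
  have : c0 = 0 by apply/rowP => i; rewrite c00 mxE.
  move: c0S; rewrite inE /S/= => /[swap] ->; rewrite normr0 => /esym/eqP.
  by rewrite oner_eq0.
exists (N c0)^-1; first by rewrite invr_gt0.
move=> c i; rewrite ler_pdivlMl//.
pose r : 'rV[R]_n.+1 := \row_i c i.
have -> : \sum_i c i *: e i = \sum_i r 0 i *: e i.
  by apply: eq_bigr => j _; rewrite mxE.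
have ri : `|c i| <= `|r| by rewrite -[c i](_ : r 0 i = _) ?coordE// mxE.
have [r0|r0] := eqVneq r 0.
  by move: ri; rewrite r0 normr0 normr_le0 => /eqP ->; rewrite normr0 mulr0.
apply: le_trans (ler_wpM2l (ltW m0) ri) _.
have rr : `|r|^-1 *: r \in S.
  by rewrite inE /S/= normrZ normfV normr_id mulVf ?normr_eq0.
rewrite -ler_pdivlMr ?normr_gt0//; apply: le_trans (c0min _ rr) _.
rewrite /N (eq_bigr (fun i => `|r|^-1 *: (r 0 i *: e i))); last first.
  by move=> j _; rewrite mxE scalerA.
by rewrite -scaler_sumr normrZ normfV normr_id mulrC.
Qed.

(** This makes [opnorm] a genuine operator norm for every linear map out of a finite-dimensional
    space. *)
Lemma has_dim_linear_clin n (E Z : normedModType R) (T : E -> Z) :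
  has_dim E n -> linear T -> T \in @clin_pred R E Z.
Proof.
move=> [e [ei esp]] Tl; have [M M0 eM] := lin_indep_coord_bound ei.
pose L : {linear E -> Z} := HB.pack T (GRing.isLinear.Build R E Z *:%R T Tl).
apply: (@bounded_linear_clin _ _ _ _ (M * \sum_i `|T (e i)|)) => // x.
have [c ->] := esp x; rewrite -[T]/(L : E -> Z) linear_sum.
apply: le_trans (ler_norm_sum _ _ _) _.
rewrite mulrAC mulr_sumr ler_sum// => i _; rewrite linearZ normrZ.
by rewrite ler_wpM2r.
Qed.

(** The coordinates of the closed unit ball form a closed set, bounded by the coordinate estimate,
    so [phi] attains its maximum there. *)
Lemma has_dim_linear_max n (E : normedModType R) (phi : E -> R) :
  has_dim E n -> linear (phi : E -> R^o) ->
  exists2 y : E, `|y| <= 1 & forall x, `|x| <= 1 -> phi x <= phi y.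
Proof.
move=> [e [ei esp]] phil; have [M M0 eM] := lin_indep_coord_bound ei.
pose L : {linear E -> R^o} :=
  HB.pack (phi : E -> R^o) (GRing.isLinear.Build R E R^o *:%R (phi : E -> R^o) phil).
pose S := [set c : 'rV[R]_n | `|\sum_i c 0 i *: e i| <= 1].
have cS : compact S.
  apply: bounded_closed_compact.
    exists M; split; first exact: num_real.
    move=> r Mr c /= cS; rewrite [leLHS]/Num.norm/= mx_normrE; apply/bigmax_leP.
    split=> [|[i j] _ /=]; first by rewrite ltW// (lt_trans M0).
    rewrite (ord1 i) (le_trans (eM (c 0) j))//.
    by rewrite (le_trans _ (ltW Mr))// ler_piMr// ltW.
  apply: (preimage_closed _ (@closed_le R 1)).
  move=> c _; apply: continuous_comp; first exact: lincomb_continuous.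
  exact: norm_continuous.
pose f (c : 'rV[R]_n) : R := \sum_i c 0 i *: (phi (e i) : R^o).
have fE (c : 'rV[R]_n) : phi (\sum_i c 0 i *: e i) = f c.
  by rewrite -[phi]/(L : E -> R^o) linear_sum; apply: eq_bigr => i _; rewrite linearZ.
have [||c cS' cmax] := EVT_max_rV _ cS (f := f).
- exists 0; rewrite /S/= big1 ?normr0// => i _; by rewrite mxE scale0r.
- apply: continuous_subspaceT; exact: (@lincomb_continuous R^o).
exists (\sum_i c 0 i *: e i); first by move: cS'; rewrite inE.
move=> x x1; have [d dE] := esp x.
have -> : x = \sum_i (\row_j d j : 'rV[R]_n) 0 i *: e i.
  by rewrite dE; apply: eq_bigr => i _; rewrite mxE.
rewrite !fE; apply: cmax; rewrite inE /S/=.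
suff -> : \sum_i (\row_j d j : 'rV[R]_n) 0 i *: e i = x by [].
by rewrite dE; apply: eq_bigr => i _; rewrite mxE.
Qed.

End finite_dimension.

(** * Banach-Mazur distance of planes and complementary projections *)

Section banach_mazur.
Context (R : realType).

Lemma has_dim_opnorm_ub n (E Z : normedModType R) (T : {linear E -> Z}) x :
  has_dim E n -> `|T x| <= opnorm T * `|x|.
Proof.
move=> En; have Tl : linear T by move=> a u v; rewrite linearP.
exact: (opnorm_ub (CLin (has_dim_linear_clin En Tl)) x).
Qed.

Lemma linear_opnorm_ge0 n (E Z : normedModType R) (T : {linear E -> Z}) :
  has_dim E n -> 0 <= opnorm T.
Proof.
move=> En; have Tl : linear T by move=> a u v; rewrite linearP.
exact: (opnorm_ge0 (CLin (has_dim_linear_clin En Tl))).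
Qed.

Lemma opnorm_le_bound (E Z : normedModType R) (T : E -> Z) (M : R) :
  0 <= M -> T 0 = 0 -> (forall x, `|T x| <= M * `|x|) -> opnorm T <= M.
Proof.
move=> M0 T0 TM; apply: ge_sup; first by exists `|T 0|, 0 => //=; rewrite normr0.
by move=> _ [x /= x1 <-]; apply: le_trans (TM x) _; rewrite ler_piMr.
Qed.

Lemma ell2_plane_normE (v : ell2_plane R) :
  `|v| ^+ 2 = v 0 0 ^+ 2 + v 0 1 ^+ 2.
Proof.
rewrite [`|v|]/Num.norm/= sqr_sqrtr; last by rewrite sumr_ge0// => i _; rewrite sqr_ge0.
by rewrite big_ord_recl big_ord1; congr (_ + v 0 _ ^+ 2); exact/val_inj.
Qed.

Lemma ell2_plane_has_dim : has_dim (ell2_plane R) 2.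
Proof.
have sumE (c : 'I_2 -> R) :
    \sum_(i < 2) c i *: (delta_mx 0 i : ell2_plane R) = \row_i c i :> 'rV[R]_2.
  apply/rowP => j; rewrite mxE summxE (bigD1 j)//= big1 => [|i ij].
    by rewrite !mxE !eqxx mulr1 addr0.
  by rewrite !mxE eq_sym (negbTE ij) andbF mulr0.
exists (fun i => delta_mx 0 i); split=> [c|x].
  by rewrite sumE => /rowP c0 i; have := c0 i; rewrite !mxE.
by exists (fun i => x 0 i); rewrite sumE; apply/rowP => i; rewrite mxE.
Qed.

Lemma span_has_dim (E : normedModType R) n (e : 'I_n -> E) : lin_indep e ->
  exists2 W : submodClosed E, has_dim (subsp W) n & forall i, e i \in W.
Proof.
move=> ei.
pose S : {pred E} := fun x => `[< exists c : 'I_n -> R, x = \sum_i c i *: e i >].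
have Scl : submod_closed S.
  split.
    by apply/asboolP; exists (fun=> 0); rewrite big1// => i _; rewrite scale0r.
  move=> a _ _ /asboolP[c ->] /asboolP[d ->]; apply/asboolP.
  exists (fun i => a * c i + d i); rewrite scaler_sumr -big_split/=.
  by apply: eq_bigr => i _; rewrite scalerDl scalerA.
pose W : submodClosed E := HB.pack S (GRing.isSubmodClosed.Build R E S Scl).
have eW i : e i \in W.
  apply/asboolP; exists (fun j => (j == i)%:R); rewrite (bigD1 i)//= big1.
    by rewrite eqxx scale1r addr0.
  by move=> j /negbTE ->; rewrite scale0r.
exists W => //; exists (fun i => Subsp (eW i)).
have valE (c : 'I_n -> R) :
    val (\sum_i c i *: (Subsp (eW i) : subsp W)) = \sum_i c i *: e i.
  by rewrite raddf_sum; apply: eq_bigr.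
split=> [c c0|[x xW]].
  by apply: ei; rewrite -valE c0 raddf0.
by have /asboolP[c xE] := xW; exists c; apply: val_inj; rewrite valE.
Qed.

(* A Riesz-type choice: [b] is, up to a factor 2, at minimal distance from the
   line through [a]. This makes the Banach-Mazur distances of all planes bounded
   by one constant, hence the supremum in [C_BM] a genuine one. *)
Lemma plane_almost_orthonormal (E : normedModType R) : has_dim E 2 ->
  exists a b : E, [/\ `|a| = 1, `|b| = 1,
    forall x, exists s t, x = s *: a + t *: b
    & forall s t : R, `|t| <= 2 * `|s *: a + t *: b|].
Proof.
move=> [e [ei esp]]; have [M M0 eM] := lin_indep_coord_bound ei.
have sumE (c : 'I_2 -> R) : \sum_i c i *: e i = c 0 *: e 0 + c 1 *: e 1.
  by rewrite big_ord_recl big_ord1; congr (_ + c _ *: e _); exact/val_inj.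
pose pr s t (i : 'I_2) : R := if i == 0 then s else t.
have prM s t : `|t| <= M * `|s *: e 0 + t *: e 1|.
  by have := eM (pr s t) 1; rewrite sumE.
have e0 : e 0 != 0.
  apply/eqP => e00; have := eM (pr 1 0) 0.
  by rewrite sumE/= e00 scaler0 scale0r addr0 normr0 mulr0 normr1 ler10.
pose a := `|e 0|^-1 *: e 0.
have a1 : `|a| = 1 by rewrite normrZ normfV normr_id mulVf ?normr_eq0.
pose A := [set r | exists t : R, r = `|e 1 + t *: a|].
have A0 : A !=set0 by exists `|e 1 + 0 *: a|, 0.
have Alb : lbound A M^-1.
  move=> _ [t ->]; rewrite -(ler_pM2l M0) divff ?gt_eqF//.
  have := prM (t * `|e 0|^-1) 1; rewrite normr1 -scalerA -/a scale1r.
  by rewrite addrC.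
have d0 : 0 < inf A.
  by apply: lt_le_trans (lb_le_inf A0 Alb); rewrite invr_gt0.
(* Taking the slack equal to [inf A] gives [|y| < 2 * inf A], the origin of the factor 2 in the
   bound on [t]. *)
have [|_ [t0 ->] yd] := inf_adherent d0 (E := A).
  by split=> //; exists M^-1.
set y := e 1 + t0 *: a in yd.
have dy s : inf A <= `|y + s *: a|.
  apply: ge_inf; first by exists M^-1.
  by exists (t0 + s); rewrite scalerDl addrA.
have y0 : 0 < `|y|.
  by apply: lt_le_trans d0 _; have := dy 0; rewrite scale0r addr0.
have aE : a = `|e 0|^-1 *: e 0 by [].
have yE : y = e 1 + t0 *: a by [].
clearbody y a; exists a, (`|y|^-1 *: y); split=> //.
- by rewrite normrZ normfV normr_id mulVf ?gt_eqF.
- move=> x; have [c ->] := esp x; rewrite sumE.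
  exists (c 0 * `|e 0| - c 1 * t0), (c 1 * `|y|).
  have -> : c 0 *: e 0 = (c 0 * `|e 0|) *: a.
    by rewrite aE scalerA mulfK ?normr_eq0.
  have -> : (c 1 * `|y|) *: (`|y|^-1 *: y) = c 1 *: y.
    by rewrite scalerA mulfK ?gt_eqF.
  rewrite yE scalerBl scalerDr scalerA.
  by rewrite [_ *: e 1 + _]addrC addrA subrK.
- move=> s t; have [->|t0'] := eqVneq t 0; first by rewrite normr0 mulr_ge0.
  have -> : s *: a + t *: (`|y|^-1 *: y) =
      (t * `|y|^-1) *: (y + (s * (t^-1 * `|y|)) *: a).
    rewrite addrC scalerDr; congr (_ + _); first by rewrite scalerA.
    rewrite (scalerA (t * _) _ a); congr (_ *: _).
    by field; rewrite t0' gt_eqF.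
  rewrite normrZ normrM normfV normr_id mulrCA -mulrA ler_peMr//.
  rewrite ler_pdivlMl// mulr1.
  by have := dy (s * (t^-1 * `|y|)); lra.
Qed.

(** In the basis [a], [b] the coordinates satisfy [|t| <= 2 |f v|], hence [|s| <= 3 |f v|], and 4 +
    9 <= 16 gives [|v| <= 4 |f v|]. Conversely [|f v| <= |s| + |t| <= 2 |v|], and 8 is the
    product. *)
Lemma plane_ell2_iso (E : normedModType R) : has_dim E 2 ->
  exists (T : {linear E -> ell2_plane R}) (Tinv : {linear ell2_plane R -> E}),
    [/\ cancel T Tinv, cancel Tinv T & opnorm T * opnorm Tinv <= 8].
Proof.
move=> /plane_almost_orthonormal[a [b [a1 b1 sp ubb]]].
pose f (v : ell2_plane R) : E := v 0 0 *: a + v 0 1 *: b.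
have fl : linear f.
  move=> k u v; rewrite /f !mxE !scalerDl scalerDr !scalerA.
  by rewrite addrACA.
pose F : {linear ell2_plane R -> E} :=
  HB.pack f (GRing.isLinear.Build R (ell2_plane R) E *:%R f fl).
have f_ge v : `|v| <= 4 * `|f v|.
  have t2 := ubb (v 0 0) (v 0 1).
  have s3 : `|v 0 0| <= 3 * `|f v|.
    have : `|v 0 0 *: a| <= `|f v| + `|v 0 1 *: b|.
      by rewrite -[v 0 0 *: a](addrK (v 0 1 *: b)) ler_normB.
    by rewrite !normrZ a1 b1 /f; lra.
  rewrite -(@ler_pXn2r _ 2) ?nnegrE ?mulr_ge0// ell2_plane_normE.
  rewrite -(real_normK (num_real (v 0 0))) -(real_normK (num_real (v 0 1))).
  rewrite -/(f v) in t2; have := normr_ge0 (v 0 0); have := normr_ge0 (v 0 1).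
  by have := normr_ge0 (f v); nra.
have f_le v : `|f v| <= 2 * `|v|.
  have c_le (r : R) : r ^+ 2 <= `|v| ^+ 2 -> `|r| <= `|v|.
    by move=> rv; rewrite -(@ler_pXn2r _ 2) ?nnegrE// real_normK ?num_real.
  have s1 : `|v 0 0| <= `|v| by apply: c_le; rewrite ell2_plane_normE lerDl sqr_ge0.
  have t1 : `|v 0 1| <= `|v| by apply: c_le; rewrite ell2_plane_normE lerDr sqr_ge0.
  by apply: le_trans (ler_normD _ _) _; rewrite !normrZ a1 b1; lra.
have fsur x : exists v, f v = x.
  have [s [t ->]] := sp x.
  exists (\row_(i < 2) if i == 0 then s else t).
  by rewrite /f !mxE.
have [g fgK] := choice fsur.
have gfK : cancel f g.
  move=> v; apply/eqP; rewrite -subr_eq0 -normr_le0.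
  apply: le_trans (f_ge _) _; rewrite -[f]/(F : _ -> _) linearB.
  by rewrite [F (g _)]fgK subrr normr0 mulr0.
have gl : linear g.
  move=> k x y; apply: (can_inj gfK); rewrite fgK.
  by rewrite -[f]/(F : _ -> _) linearP [F (g _)]fgK [F (g y)]fgK.
pose G : {linear E -> ell2_plane R} :=
  HB.pack g (GRing.isLinear.Build R E (ell2_plane R) *:%R g gl).
exists G, F; split=> //.
rewrite (_ : 8 = 4 * 2); last by ring.
have G4 : opnorm G <= 4.
  apply: opnorm_le_bound; rewrite ?linear0// => x.
  by have := f_ge (g x); rewrite fgK.
have F2 : opnorm F <= 2 by apply: opnorm_le_bound; rewrite ?linear0.
have F0 := linear_opnorm_ge0 F ell2_plane_has_dim.
by apply: le_trans (ler_wpM2r F0 G4) _; rewrite ler_wpM2l.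
Qed.

Lemma d_BM_bounds (E : normedModType R) : has_dim E 2 -> 1 <= d_BM E <= 8.
Proof.
move=> E2; have [T0 [T0inv [T0K T0invK T08]]] := plane_ell2_iso E2.
have lb1 : lbound [set r | exists (T : {linear E -> ell2_plane R})
    (Tinv : {linear ell2_plane R -> E}),
    [/\ cancel T Tinv, cancel Tinv T & r = opnorm T * opnorm Tinv]] 1.
  move=> _ [T [Tinv [TK TinvK ->]]].
  have v0 : (const_mx 1 : ell2_plane R) != 0.
    by apply/eqP => /rowP/(_ 0)/eqP; rewrite !mxE oner_eq0.
  rewrite -(@ler_pM2r _ `|const_mx 1 : ell2_plane R|) ?normr_gt0// mul1r.
  rewrite -{1}[const_mx 1]TinvK -mulrA.
  apply: le_trans (has_dim_opnorm_ub _ _ E2) _.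
  rewrite ler_wpM2l ?(linear_opnorm_ge0 _ E2)//.
  exact: has_dim_opnorm_ub ell2_plane_has_dim.
apply/andP; split.
  by apply: lb_le_inf => //; exists (opnorm T0 * opnorm T0inv), T0, T0inv.
apply: le_trans T08; apply: ge_inf; first by exists 1.
by exists T0, T0inv.
Qed.

Lemma d_BM_le_C_BM (Y : normedModType R) (W : submodClosed Y) :
  has_dim (subsp W) 2 -> d_BM (subsp W) ^+ 2 <= C_BM Y.
Proof.
move=> W2; apply: ub_le_sup; last by exists W.
exists (8 ^+ 2) => _ [W' [/d_BM_bounds/andP[d1 d8] ->]].
by rewrite ler_pXn2r ?nnegrE//; lra.
Qed.

Lemma C_BM_ge1 (Y : normedModType R) : dim_ge Y 2 -> 1 <= C_BM Y.
Proof.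
move=> [e /span_has_dim[W W2 _]]; apply: le_trans (d_BM_le_C_BM W2).
by have /andP[d1 _] := d_BM_bounds W2; rewrite expr_ge1//; lra.
Qed.

(* In the plane, [a + b = 1] is the line [P + a (X - P)] and its point closest to
   the origin gives the norm of the projection onto [P] along [X - P]; the ratio
   is the one of the complementary projection by symmetry of the Gram
   determinant. *)
Lemma ell2_plane_complementary (X P : ell2_plane R) (K : R) : 0 <= K -> P != 0 ->
  (forall a b : R, `|a + b| * `|P| <= K * `|a *: X + b *: P|) ->
  `|X - P| <= K * `|X|.
Proof.
move=> K0 P0 KP; rewrite -(@ler_pXn2r _ 2) ?nnegrE ?mulr_ge0//.
have PP : 0 < `|P| ^+ 2 by rewrite exprn_gt0 ?normr_gt0.
have [->|D0] := eqVneq (X - P) 0; first by rewrite normr0 expr0n sqr_ge0.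
have QQ : 0 < `|X - P| ^+ 2 by rewrite exprn_gt0 ?normr_gt0.
rewrite exprMn -(ler_pM2r PP) -(ler_pM2l QQ).
(* With coefficients summing to [q = |X - P|^2], the combination is [q P + a (X - P)], and this [a]
   makes it orthogonal to [X - P]: the closest point to the origin, scaled by [q] to avoid a
   division. *)
pose a := - (P 0 0 * (X - P) 0 0 + P 0 1 * (X - P) 0 1).
have := KP a (`|X - P| ^+ 2 - a); set q := `|X - P| ^+ 2.
rewrite addrC subrK => h.
have {}h : (`|q| * `|P|) ^+ 2 <= (K * `|a *: X + (q - a) *: P|) ^+ 2.
  by rewrite ler_pXn2r ?nnegrE ?mulr_ge0.
rewrite !exprMn real_normK ?num_real// in h.
rewrite mulrA -expr2.
apply: le_trans h _.
rewrite [X in _ <= X](_ : _ = K ^+ 2 * (q * (`|X| ^+ 2 * `|P| ^+ 2))); last by ring.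
rewrite ler_wpM2l ?sqr_ge0// /q !ell2_plane_normE /a !mxE.
move: (X 0 0) (X 0 1) (P 0 0) (P 0 1) => x0 x1 p0 p1.
rewrite -subr_ge0.
(* The squared norm of the combination is [q] times the Gram determinant of [X] and [P], so the gap
   is [q] times their squared inner product. *)
rewrite [X in 0 <= X](_ : _ = ((x0 - p0) ^+ 2 + (x1 - p1) ^+ 2) *
  (x0 * p0 + x1 * p1) ^+ 2); last by ring.
by rewrite mulr_ge0 ?addr_ge0 ?sqr_ge0.
Qed.

Lemma plane_complementary (E : normedModType R) (x p : E) (K : R) :
  has_dim E 2 -> 0 <= K -> p != 0 ->
  (forall a b : R, `|a + b| * `|p| <= K * `|a *: x + b *: p|) ->
  `|x - p| <= K * d_BM E ^+ 2 * `|x|.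
Proof.
move=> E2 K0 p0 Kp.
(* One factor [opnorm T * opnorm Tinv] is lost on carrying the projection bound to the Euclidean
   plane, another on carrying the complementary bound back. *)
have key (T : {linear E -> ell2_plane R}) (Tinv : {linear ell2_plane R -> E}) :
    cancel T Tinv -> cancel Tinv T ->
    `|x - p| <= K * (opnorm T * opnorm Tinv) ^+ 2 * `|x|.
  move=> TK TinvK; have T0 := linear_opnorm_ge0 T E2.
  have Ti0 := linear_opnorm_ge0 Tinv ell2_plane_has_dim.
  have Tub := has_dim_opnorm_ub T _ E2.
  have Tiub := has_dim_opnorm_ub Tinv _ ell2_plane_has_dim.
  have TP : `|T x - T p| <= opnorm T * opnorm Tinv * K * `|T x|.
    apply: ell2_plane_complementary.
    - by rewrite !mulr_ge0.
    - by rewrite -(inj_eq (can_inj TinvK)) linear0 TK.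
    move=> a b; rewrite -!linearZ -linearD.
    apply: le_trans (ler_wpM2l (normr_ge0 _) (Tub p)) _.
    rewrite mulrCA -!mulrA ler_wpM2l//; apply: le_trans (Kp a b) _.
    rewrite mulrCA ler_wpM2l// -{1}[a *: x + b *: p]TK; exact: Tiub.
  rewrite -[x - p]TK linearB; apply: le_trans (Tiub _) _.
  rewrite (_ : K * _ * _ = opnorm Tinv *
     (opnorm T * opnorm Tinv * K * (opnorm T * `|x|))); last by ring.
  rewrite ler_wpM2l//; apply: le_trans TP _.
  by rewrite ler_wpM2l ?mulr_ge0//; exact: Tub.
have Kpx : `|p| <= K * `|x|.
  by have := Kp 1 0; rewrite scale0r scale1r !addr0 normr1 mul1r.
have Kx : 0 < K * `|x| by apply: lt_le_trans Kpx; rewrite normr_gt0.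
rewrite mulrAC -ler_pdivrMl//.
(* The infimum [d_BM] need not be attained: [key] makes the square root of [q] a lower bound of all
   products [opnorm T * opnorm Tinv]. *)
set q := _^-1 * _; have q0 : 0 <= q by rewrite mulr_ge0 ?invr_ge0 ?(ltW Kx).
have /andP[d1 _] := d_BM_bounds E2.
rewrite -(sqr_sqrtr q0) ler_pXn2r ?nnegrE ?sqrtr_ge0//; last by lra.
have [T0 [T0inv [T0K T0invK _]]] := plane_ell2_iso E2.
apply: lb_le_inf; first by exists (opnorm T0 * opnorm T0inv), T0, T0inv.
move=> _ [T [Tinv [TK TinvK ->]]].
have D0 : 0 <= opnorm T * opnorm Tinv.
  rewrite mulr_ge0 ?(linear_opnorm_ge0 T E2)//.
  exact: linear_opnorm_ge0 ell2_plane_has_dim.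
rewrite -(@ler_pXn2r _ 2) ?nnegrE ?sqrtr_ge0// sqr_sqrtr//.
by rewrite ler_pdivrMl// mulrAC; exact: key.
Qed.

Lemma complementary_le_C_BM (Y : normedModType R) (x p : Y) (K : R) :
  0 <= K -> (forall s t : R, s *: x + t *: p = 0 -> s = 0 /\ t = 0) ->
  (forall a b : R, `|a + b| * `|p| <= K * `|a *: x + b *: p|) ->
  `|x - p| <= K * C_BM Y * `|x|.
Proof.
move=> K0 xp Kp; pose e (i : 'I_2) := if i == 0 then x else p.
have sumE (c : 'I_2 -> R) : \sum_i c i *: e i = c 0 *: x + c 1 *: p.
  by rewrite big_ord_recl big_ord1; congr (_ + c _ *: _); exact/val_inj.
have ei : lin_indep e.
  move=> c; rewrite sumE => /xp[c0 c1] [[|[|//]] i2].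
    by rewrite -[RHS]c0; congr c; exact/val_inj.
  by rewrite -[RHS]c1; congr c; exact/val_inj.
have [W W2 eW] := span_has_dim ei.
pose x' : subsp W := Subsp (eW 0); pose p' : subsp W := Subsp (eW 1).
have p0 : p' != 0.
  apply/eqP => /(congr1 val)/= p0; have [|_ /eqP] := xp 0 1.
    by rewrite scale0r add0r scale1r.
  by rewrite oner_eq0.
have := @plane_complementary (subsp W) x' p' K W2 K0 p0 Kp.
move=> /le_trans; apply; rewrite ler_wpM2r// ler_wpM2l//.
exact: d_BM_le_C_BM.
Qed.

End banach_mazur.

(** * The asymmetric-orthogonality constant *)

Section asymmetric_orthogonality.
Context (R : realType) (V : normedModType R).
Implicit Types (y z r : V) (g j : dual V).

Lemma dualE g v : g v <= `|g| * `|v|.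
Proof. by apply: le_trans (ler_norm _) _; exact: opnorm_ub. Qed.

Lemma duality_mapping_norm y g : duality_mapping y g -> `|g| = `|y|.
Proof.
by move=> [_ /eqP]; rewrite eqrXn2// => /eqP ->.
Qed.

Lemma duality_mappingZ t y g :
  duality_mapping y g -> duality_mapping (t *: y) (t *: g).
Proof.
move=> yg; have := duality_mapping_norm yg; case: yg => gy _ gN; split.
  rewrite -[LHS]/(t * g (t *: y)) linearZ/= gy normrZ exprMn.
  by rewrite real_normK ?num_real// mulrA.
by rewrite !normrZ gN.
Qed.

Lemma orthN r y : orth r y -> orth r (- y).
Proof.
move=> [g yg gr]; exists (- g).
  by have := duality_mappingZ (-1) yg; rewrite !scaleN1r.
by rewrite -[LHS]/(- g r) gr oppr0.
Qed.

(** All quotients are at most 1 since [|j| = |r|], so the supremum is genuine; for [r = 0] or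
    [y = 0] both sides vanish or the bound is trivial. *)
Lemma C_AO_ub r y j :
  duality_mapping r j -> orth r y -> j y <= C_AO V * (`|y| * `|r|).
Proof.
move=> rj ry; have jN := duality_mapping_norm rj.
have [r0|r0] := eqVneq r 0.
  by have := dualE j y; rewrite jN r0 normr0 mul0r !mulr0.
have [->|y0] := eqVneq y 0; first by rewrite linear0 normr0 mul0r mulr0.
rewrite -ler_pdivrMr ?mulr_gt0 ?normr_gt0//.
apply: ub_le_sup; last by exists r, y, j.
exists 1 => _ [z0 [z [k [z00 zz0 _ kz ->]]]].
rewrite ler_pdivrMr ?mulr_gt0 ?normr_gt0// mul1r mulrC.
by rewrite -(duality_mapping_norm kz); exact: dualE.
Qed.

(** Orthogonality survives replacing [y] by [- y], so each quotient occurs with both signs; the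
    supremum of the empty set is 0 by convention. *)
Lemma C_AO_ge0 : 0 <= C_AO V.
Proof.
rewrite /C_AO; set A := [set r | _].
have [->|/set0P[_ [r [y [j [r0 y0 ry rj _]]]]]] := eqVneq A set0.
  by rewrite sup0.
have := C_AO_ub rj ry; have := C_AO_ub rj (orthN ry).
rewrite linearN normrN -/A.
have : 0 < `|y| * `|r| by rewrite mulr_gt0 ?normr_gt0.
rewrite -/A -/(C_AO V) => yr /[swap] h1 h2.
by rewrite -(pmulr_lge0 _ yr); lra.
Qed.

End asymmetric_orthogonality.

(** * Stability and error bound for the mixed problem *)

Section mixed_problem.
Context (R : realType) (U V : normedModType R) (B : clin U (dual V)).
Context (M_B gamma_B C_Pi : R).
Hypothesis gamma_B_gt0 : 0 < gamma_B.
Hypothesis B_bounds : forall w : U, gamma_B * `|w| <= `|B w| <= M_B * `|w|.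
Hypothesis C_Pi_gt0 : 0 < C_Pi.
Context (Un : submodClosed U) (Vm : submodClosed V).
Hypothesis Vm_fin : finite_dim (subsp Vm).
Context (Pi : V -> V).
Hypothesis Pi_in : forall v : V, Pi v \in Vm.
Hypothesis Pi_bound : forall v : V, `|Pi v| <= C_Pi * `|v|.
Hypothesis Fortin :
  forall (w_n : U) (v : V), w_n \in Un -> B w_n (v - Pi v) = 0.

(* [j] is an arbitrary element of the duality mapping instead of [Jmap r]: this
   makes the relation visibly homogeneous in [(x, p)]. *)
Definition mixed_solution (x p : U) := p \in Un /\
  exists (r : V) (j : dual V), [/\ r \in Vm, duality_mapping r j,
    forall v, v \in Vm -> j v + B p v = B x v
  & forall w, w \in Un -> B w r = 0].

Lemma mixed_solution_add t x p w : w \in Un -> mixed_solution x p ->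
  mixed_solution (t *: x + w) (t *: p + w).
Proof.
move=> wU [pU [r [j [rV rj eq1 eq2]]]]; split; first by rewrite rpredD ?rpredZ.
exists (t *: r), (t *: j); split.
- by rewrite rpredZ.
- exact: duality_mappingZ.
- move=> v vV; rewrite !linearP.
  rewrite -[LHS]/(t * j v + (t * B p v + B w v)) -[RHS]/(t * B x v + B w v).
  by rewrite addrA -mulrDr eq1.
- by move=> w' w'U; rewrite linearZ/= eq2// scaler0.
Qed.

Let K := C_Pi / gamma_B * (1 + C_AO V) * M_B.

Lemma mixed_solution_stable x p : mixed_solution x p -> `|p| <= K * `|x|.
Proof.
move=> [pU [r [j [rV rj eq1 eq2]]]].
have [n Vmn] := Vm_fin.
have [|[y yV] y1 ymax] := @has_dim_linear_max _ n (subsp Vm) (fun v => B p (val v)) Vmn.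
  by move=> a u v; rewrite -[RHS](linearP (B p)).
set s := B p y.
have smax v : v \in Vm -> B p v <= s * `|v|.
  move=> vV; have [->|v0] := eqVneq v 0.
    by rewrite linear0 normr0 mulr0.
  have := ymax (`|v|^-1 *: (Subsp vV : subsp Vm)).
  rewrite -[X in X <= 1 -> _]/(`| `|v|^-1 *: v|) normrZ normfV normr_id.
  rewrite mulVf ?normr_eq0// => /(_ (lexx _)).
  rewrite -[leLHS]/(B p (`|v|^-1 *: v)) linearZ/= ler_pdivrMl ?normr_gt0//.
  by rewrite mulrC.
have s0 : 0 <= s.
  by have := ymax 0; rewrite normr0 ler01 => /(_ isT); rewrite linear0.
(* By the Fortin condition [B p v = B p (Pi v)], where only the norm on [Vm] matters. *)
have Bps : `|B p| <= C_Pi * s.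
  have Bpv v : B p v <= C_Pi * s * `|v|.
    have -> : B p v = B p (Pi v).
      by have /eqP := Fortin v pU; rewrite linearB subr_eq0 => /eqP.
    apply: le_trans (smax _ (Pi_in v)) _.
    by rewrite [leRHS]mulrAC [leRHS]mulrC ler_wpM2l.
  apply: opnorm_le => v v1; apply: le_trans (_ : _ <= C_Pi * s * `|v|) _.
    by rewrite ler_norml Bpv andbT lerNl; have := Bpv (- v); rewrite linearN normrN.
  by rewrite ler_piMr// mulr_ge0// ltW.
have AO0 := C_AO_ge0 V.
have sx : s <= (1 + C_AO V) * `|B x|.
  have [s00|sN0] := eqVneq s 0; first by rewrite s00 mulr_ge0// addr_ge0.
  have sp : 0 < s by rewrite lt_neqAle eq_sym sN0.
  (* From [g y = s], [|g| <= s] and [|y| <= 1] both inequalities become equalities, so [g] lies in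
     the duality mapping of [s *: y]. *)
  have [g gs gE] := dual_extension s0 smax.
  have gy : g y = s by rewrite gE.
  have gyN : s <= `|g| * `|y| by rewrite -gy; exact: dualE.
  have yN : `|y| = 1.
    apply/le_anti; rewrite y1/= -(ler_pM2l sp) mulr1.
    by apply: le_trans gyN _; rewrite ler_wpM2r.
  have gN : `|g| = s by apply/le_anti; rewrite gs -[`|g|]mulr1 -yN.
  have zg : duality_mapping (s *: y) g.
    by split; rewrite ?linearZ/= ?gy normrZ yN mulr1 ?gN ger0_norm.
  (* The sign is reversed because [s = B x y - j y] calls for an upper bound on [- j y]. *)
  have rz : orth r (- (s *: y)).
    by apply: orthN; exists g => //; rewrite gE// eq2.
  (* Testing the first equation with [r] itself removes [B p] and leaves [|r|^2 = B x r]. *)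
  have rB : `|r| <= `|B x|.
    have [->|r0] := eqVneq r 0; first by rewrite normr0.
    rewrite -(@ler_pM2r _ `|r|) ?normr_gt0// -expr2.
    have [<- _] := rj; have := eq1 _ rV; rewrite eq2// addr0 => ->.
    exact: dualE.
  have jy : - j y <= C_AO V * `|r|.
    rewrite -(ler_pM2l sp); have := C_AO_ub rj rz.
    rewrite linearN linearZ/= normrN normrZ yN ger0_norm//.
    by rewrite -[s *: j y]/(s * j y); lra.
  have := eq1 _ yV; have := dualE (B x) y; rewrite yN mulr1 -/s => Bxy jyE.
  have : C_AO V * `|r| <= C_AO V * `|B x| by rewrite ler_wpM2l.
  by rewrite mulrDl mul1r; lra.
have /andP[_ Bx] := B_bounds x; have /andP[Bp _] := B_bounds p.
rewrite /K -(ler_pM2l gamma_B_gt0); apply: le_trans Bp _.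
apply: le_trans Bps _.
have -> : gamma_B * (C_Pi / gamma_B * (1 + C_AO V) * M_B * `|x|) =
    C_Pi * ((1 + C_AO V) * (M_B * `|x|)) by field; rewrite gt_eqF.
rewrite ler_pM2l//; apply: le_trans sx _.
by rewrite ler_wpM2l// addr_ge0.
Qed.

(** The residual is 0. Stability at a nonzero [w] then yields [1 <= K], which settles the case
    [p = 0] below. *)
Lemma mixed_solution_id w : w \in Un -> mixed_solution w w.
Proof.
move=> wU; split=> //; exists 0, 0; split.
- exact: rpred0.
- by split; rewrite ?linear0 !normr0 ?expr0n.
- by move=> v _; rewrite -[LHS]/(0 + B w v) add0r.
- by move=> w' _; rewrite linear0.
Qed.

Lemma mixed_solution_near x p : dim_ge U 2 ->
  (exists2 w : U, w \in Un & w != 0) -> mixed_solution x p ->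
  `|x - p| <= Num.min (K * C_BM U) (1 + K) * `|x|.
Proof.
move=> dimU [w wU w0] xp; have pU := xp.1.
have K1 : 1 <= K.
  have := mixed_solution_stable (mixed_solution_id wU).
  by rewrite -{1}[`|w|]mul1r ler_pM2r// normr_gt0.
have K0 : 0 <= K by lra.
have BM1 := C_BM_ge1 dimU.
have px := mixed_solution_stable xp.
rewrite minr_pMl// le_min; apply/andP; split; last first.
  by rewrite mulrDl mul1r; apply: le_trans (ler_normB _ _) _; rewrite lerD2l.
have KB1 : 1 <= K * C_BM U by rewrite -[1]mulr1 ler_pM.
have Kp a b : `|a + b| * `|p| <= K * `|a *: x + b *: p|.
  have bpU : b *: p \in Un by rewrite rpredZ.
  have := mixed_solution_stable (mixed_solution_add a bpU xp).
  by rewrite -scalerDl normrZ.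
have [p0|p0] := eqVneq p 0.
  by rewrite p0 subr0 -{1}[`|x|]mul1r ler_wpM2r.
have [->|xNp] := eqVneq x p; first by rewrite subrr normr0 mulr_ge0// (le_trans ler01).
apply: complementary_le_C_BM => // s t st.
(* A vanishing combination forces [s + t = 0] by [Kp], hence [s *: (x - p) = 0]; so [x] and [p] span
   a plane. *)
have : `|s + t| * `|p| <= 0 by have := Kp s t; rewrite st normr0 mulr0.
rewrite pmulr_lle0 ?normr_gt0// normr_le0 addrC addr_eq0 => /eqP tE.
move/eqP: st; rewrite tE scaleNr -scalerBr scaler_eq0 subr_eq0 (negbTE xNp) orbF.
by move=> /eqP ->; rewrite oppr0.
Qed.

End mixed_problem.

(** * Quasi-optimality of the discrete solution *)

Theorem theorem4 (R : realType) (U V : completeNormedModType R)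
    (dimU : dim_ge U 2) (dimV : dim_ge V 2)
    (B : clin U (dual V)) (M_B gamma_B : R)
    (M_B_gt0 : 0 < M_B) (gamma_B_gt0 : 0 < gamma_B)
    (B_bounds : forall w : U, gamma_B * `|w| <= `|B w| <= M_B * `|w|)
    (V_reflexive : reflexive_space V) (Vd_reflexive : reflexive_space (dual V))
    (V_convex : strictly_convex V) (Vd_convex : strictly_convex (dual V))
    (C_Pi D_Pi : R) (C_Pi_gt0 : 0 < C_Pi) (D_Pi_gt0 : 0 < D_Pi)
    (Un : submodClosed U) (Vm : submodClosed V)
    (Un_fin : finite_dim (subsp Un)) (Vm_fin : finite_dim (subsp Vm))
    (Un_neq0 : exists2 w : U, w \in Un & w != 0)
    (Pi : V -> V) (Pi_in : forall v : V, Pi v \in Vm)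
    (Pi_bound : forall v : V, `|Pi v| <= C_Pi * `|v|)
    (subPi_bound : forall v : V, `|v - Pi v| <= D_Pi * `|v|)
    (Fortin : forall (w_n : U) (v : V), w_n \in Un -> B w_n (v - Pi v) = 0)
    (u : U) (f : dual V) (f_eq : f = B u)
    (r_m : V) (u_n : U) (r_m_in : r_m \in Vm) (u_n_in : u_n \in Un)
    (eq1 : forall v_m : V, v_m \in Vm -> Jmap r_m v_m + B u_n v_m = f v_m)
    (eq2 : forall w_n : U, w_n \in Un -> adjoint B r_m w_n = 0) :
  `|u - u_n| <=
    Num.min (C_Pi / gamma_B * (1 + C_AO V) * M_B * C_BM U)
            (1 + C_Pi / gamma_B * (1 + C_AO V) * M_B)
    * inf [set `|u - w_n| | w_n in [set w : U | w \in Un]].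
Proof.
have sol : mixed_solution B Un Vm u u_n.
  split=> //; exists r_m, (Jmap r_m); split=> // [|v vV].
    exact: (xgetPex 0 (duality_mapping_neq0 r_m)).
  by rewrite eq1// f_eq.
have near w : w \in Un -> `|u - u_n| <=
    Num.min (C_Pi / gamma_B * (1 + C_AO V) * M_B * C_BM U)
            (1 + C_Pi / gamma_B * (1 + C_AO V) * M_B) * `|u - w|.
  (* Shifting data and solution by [w] leaves the error unchanged and replaces [|u|] by [|u - w|] on
     the right. *)
  move=> wU; have NwU : - w \in Un by rewrite -scaleN1r rpredZ.
  have := mixed_solution_add 1 NwU sol; rewrite !scale1r => solw.
  have := mixed_solution_near gamma_B_gt0 B_bounds C_Pi_gt0 Vm_fin Pi_in Pi_bound
    Fortin dimU Un_neq0 solw.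
  by rewrite opprB addrA subrK.
set C := Num.min _ _ in near *.
(* Positivity allows division by [C], which turns the bounds for single [w] into a lower bound of
   the set under the infimum. *)
have C0 : 0 < C.
  have K0 : 0 < C_Pi / gamma_B * (1 + C_AO V) * M_B.
    rewrite !mulr_gt0 ?invr_gt0//.
    by have := C_AO_ge0 V; lra.
  rewrite /C lt_min mulr_gt0 ?(lt_le_trans ltr01 (C_BM_ge1 dimU))//=.
  by rewrite addr_gt0.
rewrite -ler_pdivrMl//; apply: lb_le_inf.
  by exists `|u - u_n|, u_n.
by move=> _ [w /= wU <-]; rewrite ler_pdivrMl//; exact: near.
Qed.
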